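(* Let $n\geq 3$ and let $S$ be a subset of $\mathcal{IP}_n$. Then the following statements are equivalent: (1) $S$ is a maximal subsemigroup of $\mathcal{IP}_n$; (2) either $S=\mathcal{IT}_n\cup I_{n-2}$, or $S=G\cup I_{n-1}$ for some maximal subgroup $G$ of $\mathcal{S}_n$. In addition, every maximal subsemigroup of $\mathcal{IP}_n$ is an inverse subsemigroup of $\mathcal{IP}_n$.
   Context: Let $X$ be an arbitrary set and let $X'=\{x':x\in X\}$ be a disjoint copy of $X$, with $x\mapsto x'$ a fixed bijection $X\to X'$; the inverse bijection is also denoted by $'$, and $B'=\{x':x\in B\}$ for $B\subseteq X$. Let $\mathcal{CS}_X$ be the set of all partitions of $X\cup X'$ into nonempty blocks. For $a\in\mathcal{CS}_X$ write $x\equiv_a y$ if $x,y\in X\cup X'$ lie in the same block of $a$. The product $ab$ of $a,b\in\mathcal{CS}_X$ is the partition corresponding to the equivalence relation $\equiv$ on $X\cup X'$ defined, for $x,y\in X$, by: (i) $x\equiv y$ iff $x\equiv_a y$ or there are $s\ge 1$ and $c_1,\dots,c_{2s}\in X$ with $x\equiv_a c_1'$, $c_1\equiv_b c_2$, $c_2'\equiv_a c_3'$, $\dots$, $c_{2s-1}\equiv_b c_{2s}$, $c_{2s}'\equiv_a y$; (ii) $x'\equiv y'$ iff $x'\equiv_b y'$ or there are $s\ge 1$ and $c_1,\dots,c_{2s}\in X$ with $x'\equiv_b c_1$, $c_1'\equiv_a c_2'$, $c_2\equiv_b c_3$, $\dots$, $c_{2s-1}'\equiv_a c_{2s}'$,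 $c_{2s}\equiv_b y'$; (iii) $x\equiv y'$ iff $y'\equiv x$ iff there are $s\ge 1$ and $c_1,\dots,c_{2s-1}\in X$ with $x\equiv_a c_1'$, $c_1\equiv_b c_2$, $c_2'\equiv_a c_3'$, $\dots$, $c_{2s-2}'\equiv_a c_{2s-1}'$, $c_{2s-1}\equiv_b y'$. With this product $\mathcal{CS}_X$ is a semigroup, and $\mathcal{IP}_X$ is the subsemigroup (an inverse semigroup) of all $a\in\mathcal{CS}_X$ each of whose blocks meets both $X$ and $X'$. For $X=\{1,\dots,n\}$ write $\mathcal{IP}_n$. The rank of $a\in\mathcal{IP}_n$ is the number of its blocks, and $I_k=\{a\in\mathcal{IP}_n:\mathrm{rank}(a)\le k\}$. The symmetric group $\mathcal{S}_n$ (permutations multiplied left to right, $(gh)(x)=h(g(x))$) is identified with a subgroup of $\mathcal{IP}_n$ via $g\mapsto\{\{x,g(x)'\}:x\in\{1,\dots,n\}\}$. Let $\tau_{1,2}\in\mathcal{IP}_n$ be the partition with blocks $\{1,2,1',2'\}$ and $\{x,x'\}$ for $x\ne 1,2$. For $n\ge2$, $\mathcal{IT}_n=\langle\mathcal{S}_n,\tau_{1,2}\rangle$ is the subsemigroup generated by $\mathcal{S}_n$ and $\tau_{1,2}$. A maximal subsemigroup (subgroup) is a proper subsemigroup (subgroup) not properly contained in another proper one. An inverse subsemigroup is a subsemigroup closed under taking inverses. *)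

(* Defs.v *)
From HB Require Import structures.
From mathcomp Require Import all_boot all_order all_fingroup all_solvable.
From mathcomp Require Import boolp.

Set Implicit Arguments.
Unset Strict Implicit.
Unset Printing Implicit Defensive.

(* The disjoint union of X and its copy X' is the sum type X + X:
   inl x stands for x and inr x for x'. *)

Section Product_relation.
Variable X : finType.
Implicit Types (ea eb : rel (X + X)) (u v : X + X).

(* c 1, ..., c m (the other values of c are irrelevant), consecutive terms
   being related by r1 and r2 alternately, starting with r1. *)
Definition alternating (r1 r2 : rel X) (m : nat) (c : nat -> X) : Prop :=
  forall i, 0 < i < m -> (if odd i then r1 else r2) (c i) (c i.+1).

Definition upper e : rel X := fun x y : X => e (inl x : X + X) (inl y : X + X).
Definition lower e : rel X := fun x y : X => e (inr x : X + X) (inr y : X + X).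

Definition prod_upper ea eb (x y : X) : Prop :=
  ea (inl x) (inl y) \/
  exists (s : nat) (c : nat -> X),
    [/\ 0 < s, ea (inl x) (inr (c 1)),
        alternating (upper eb) (lower ea) s.*2 c
      & ea (inr (c s.*2)) (inl y)].

Definition prod_lower ea eb (x y : X) : Prop :=
  eb (inr x) (inr y) \/
  exists (s : nat) (c : nat -> X),
    [/\ 0 < s, eb (inr x) (inl (c 1)),
        alternating (lower ea) (upper eb) s.*2 c
      & eb (inl (c s.*2)) (inr y)].

Definition prod_mixed ea eb (x y : X) : Prop :=
  exists (s : nat) (c : nat -> X),
    [/\ 0 < s, ea (inl x) (inr (c 1)),
        alternating (upper eb) (lower ea) s.*2.-1 c
      & eb (inl (c s.*2.-1)) (inr y)].

Definition prod_rel ea eb u v : Prop :=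
  match u, v with
  | inl x, inl y => prod_upper ea eb x y
  | inr x, inr y => prod_lower ea eb x y
  | inl x, inr y => prod_mixed ea eb x y
  | inr x, inl y => prod_mixed ea eb y x
  end.

(* prod_rel is an equivalence relation, being connectedness in the graph on
   three copies of X (inl (inl x) top, inr x middle, inl (inr x) bottom) with
   ea between top and middle and eb between middle and bottom. *)

Let node : finType := ((X + X) + X)%type.

Let na (p : node) : option (X + X) :=
  match p with
  | inl (inl x) => Some (inl x) | inr x => Some (inr x) | inl (inr _) => None
  end.

Let nb (p : node) : option (X + X) :=
  match p with
  | inl (inr x) => Some (inr x) | inr x => Some (inl x) | inl (inl _) => None
  end.

Let orel (e : rel (X + X)) : rel (option (X + X)) := fun o1 o2 =>
  match o1, o2 with Some u, Some v => e u v | _, _ => false end.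

Let step ea eb : rel node := fun p q =>
  orel ea (na p) (na q) || orel eb (nb p) (nb q).

Let flip (e : rel (X + X)) : rel (X + X) := fun u v =>
  let sw w := match w with inl x => inr x | inr x => inl x end in
  e (sw u) (sw v).

Let nflip (p : node) : node :=
  match p with
  | inl (inl x) => inl (inr x) | inl (inr x) => inl (inl x) | inr x => inr x
  end.

Let step_flip ea eb p q : step ea eb p q -> step (flip eb) (flip ea) (nflip p) (nflip q).
Proof. by rewrite /step orbC; case: p => [[x|x]|x]; case: q => [[y|y]|y]. Qed.

Let connect_flip ea eb p q : connect (step ea eb) p q ->
  connect (step (flip eb) (flip ea)) (nflip p) (nflip q).
Proof.
case/connectP=> w; elim: w p => [|r w IHw] p /= => [_ -> //|].
by case/andP=> pr rw qE; apply: connect_trans (connect1 (step_flip pr)) (IHw r rw qE).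
Qed.

Let step_sym ea eb : equivalence_rel ea -> equivalence_rel eb ->
  symmetric (step ea eb).
Proof.
move=> /equivalence_relP[ra ta] /equivalence_relP[rb tb].
have sa: symmetric ea by move=> u v; apply/idP/idP => /ta <-.
have sb: symmetric eb by move=> u v; apply/idP/idP => /tb <-.
have so e: symmetric e -> symmetric (orel e) by move=> se [u|] [v|] /=.
by move=> p q; rewrite /step so // [X in _ || X]so.
Qed.

Let alternating_connect ea eb b m (c : nat -> X) : 0 < m ->
    alternating (if b then upper eb else lower ea)
                (if b then lower ea else upper eb) m c ->
  connect (step ea eb) (inr (c 1)) (inr (c m)).
Proof.
case: m => // m _; elim: m => // m IHm alt.
apply: (@connect_trans _ _ (inr (c m.+1))).
  by apply: IHm => i /andP[i0 im]; apply: alt; rewrite i0 ltnW.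
apply: connect1; have := alt m.+1; rewrite ltnS leqnn /step /= => /(_ isT).
by case: b {alt IHm} => /=; case: odd; rewrite /upper /lower => /= ->; rewrite ?orbT.
Qed.

Let prod_connect ea eb u v : equivalence_rel ea -> equivalence_rel eb ->
  prod_rel ea eb u v -> connect (step ea eb) (inl u) (inl v).
Proof.
move=> Ea Eb; have csym := sym_connect_sym (step_sym Ea Eb).
have mixed x y : prod_mixed ea eb x y ->
    connect (step ea eb) (inl (inl x)) (inl (inr y)).
  case=> s [c [s0 xc alt cy]].
  have m0 : 0 < s.*2.-1 by case: s s0 {alt cy}.
  apply: (connect_trans (connect1 _) (connect_trans
    (@alternating_connect ea eb true _ c m0 alt) (connect1 _)));
  by rewrite /step /= ?xc ?cy ?orbT.
case: u v => [x|x] [y|y] /=; [|exact: mixed|by rewrite csym; exact: mixed|].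
- case=> [xy|[s [c [s0 xc alt cy]]]]; first by apply: connect1; rewrite /step /= xy.
  have m0 : 0 < s.*2 by rewrite double_gt0.
  apply: (connect_trans (connect1 _) (connect_trans
    (@alternating_connect ea eb true _ c m0 alt) (connect1 _)));
  by rewrite /step /= ?xc ?cy ?orbT.
- case=> [xy|[s [c [s0 xc alt cy]]]]; first by apply: connect1; rewrite /step /= xy ?orbT.
  have m0 : 0 < s.*2 by rewrite double_gt0.
  apply: (connect_trans (connect1 _) (connect_trans
    (@alternating_connect ea eb false _ c m0 alt) (connect1 _)));
  by rewrite /step /= ?xc ?cy ?orbT.
Qed.

Let chain ea eb x m d : Prop := exists c : nat -> X,
  [/\ 0 < m, ea (inl x) (inr (c 1)),
      alternating (upper eb) (lower ea) m c & c m = d].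

Let chain_rcons ea eb x m d d' : chain ea eb x m d ->
  (if odd m then upper eb else lower ea) d d' -> chain ea eb x m.+1 d'.
Proof.
move=> [c [m0 xc alt cd]] dd'; exists (fun i => if i <= m then c i else d').
split=> //; rewrite ?m0 ?ltnn // => i /andP[i0]; rewrite ltnS leq_eqVlt.
case/orP=> [/eqP->|im] /=; first by rewrite eqxx ltnn cd.
by rewrite im orbT; apply: alt; rewrite i0.
Qed.

Let reach ea eb x (p : node) : Prop :=
  match p with
  | inl (inl y) => prod_upper ea eb x y
  | inl (inr y) => prod_mixed ea eb x y
  | inr d => exists m, chain ea eb x m d
  end.

Let reach_step ea eb x p q : equivalence_rel ea -> equivalence_rel eb ->
  reach ea eb x p -> step ea eb p q -> reach ea eb x q.
Proof.
move=> /equivalence_relP[ra ta] /equivalence_relP[rb tb].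
have transa u v w : ea u v -> ea v w -> ea u w by move=> /ta->.
have transb u v w : eb u v -> eb v w -> eb u w by move=> /tb->.
have parity (b : bool) d : (exists m, chain ea eb x m d) ->
    exists2 m, odd m = b & chain ea eb x m d.
  case=> m ch; have [mb|mb] := eqVneq (odd m) b; first by exists m.
  exists m.+1; first by rewrite /=; case: odd b mb => [] [].
  by apply: chain_rcons ch _; case: odd; [apply: rb|apply: ra].
have even m : odd m = false -> m = m./2.*2.
  by move=> om; rewrite -[LHS]odd_double_half om.
have oddE m : odd m = true -> m = m./2.+1.*2.-1.
  by move=> om; rewrite -[LHS]odd_double_half om.
have mid1 d : ea (inl x) (inr d) -> reach ea eb x (inr d).
  by move=> xd; exists 1, (fun=> d); split=> // i; case: i => [|[]].
case: p => [[y|y]|d]; case: q => [[z|z]|d'] //=; rewrite /step /= ?orbF //.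
- case=> [xy|[s [c [s0 xc alt cy]]]] yz; first by left; apply: transa yz.
  by right; exists s, c; split=> //; apply: transa yz.
- case=> [xy|[s [c [s0 xc alt cy]]]] yd.
    by apply: mid1; apply: transa yd.
  exists s.*2.+1; apply: (@chain_rcons _ _ _ _ (c s.*2)).
    by exists c; split; rewrite // double_gt0.
  by rewrite odd_double; apply: transa yd.
- by case=> [s [c [s0 xc alt cy]]] yz; exists s, c; split=> //; apply: transb yz.
- case=> [s [c [s0 xc alt cy]]] yd.
  exists s.*2.-1.+1; apply: (@chain_rcons _ _ _ _ (c s.*2.-1)).
    by exists c; split=> //; case: s s0 {alt cy}.
  have -> : odd s.*2.-1 by case: s s0 {alt cy} => // s _; rewrite /= odd_double.
  by apply: transb yd.
- case/(parity false)=> m om [c [m0 xc alt cd]] dz; right.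
  exists m./2, c; rewrite -(even m om); split=> //; last by rewrite cd.
  by rewrite -double_gt0 -even.
- case/(parity true)=> m om [c [m0 xc alt cd]] dz.
  by exists m./2.+1, c; rewrite -(oddE m om); split=> //; rewrite cd.
- move=> ch /orP[dd|dd].
    have [m om ch1] := parity false d ch.
    by exists m.+1; apply: chain_rcons ch1 _; rewrite om.
  have [m om ch1] := parity true d ch.
  by exists m.+1; apply: chain_rcons ch1 _; rewrite om.
Qed.

Let connect_reach ea eb x p : equivalence_rel ea -> equivalence_rel eb ->
  connect (step ea eb) (inl (inl x)) p -> reach ea eb x p.
Proof.
move=> Ea Eb /connectP[w]; have: reach ea eb x (inl (inl x)).
  by left; have /equivalence_relP[ra _] := Ea; apply: ra.
elim: w (inl _ : node) => [|r w IHw] q /= => [rq _ -> //|rq /andP[qr rw] pE].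
by apply: IHw rw pE; apply: reach_step qr.
Qed.

Lemma prod_relP ea eb u v : equivalence_rel ea -> equivalence_rel eb ->
  prod_rel ea eb u v <-> connect (step ea eb) (inl u) (inl v).
Proof.
move=> Ea Eb; split; first exact: prod_connect.
case: u v => [x|x] [y|y]; try exact: connect_reach.
  by rewrite (sym_connect_sym (step_sym Ea Eb)); apply: connect_reach.
move/connect_flip => /= xy.
have Ef e : equivalence_rel e -> equivalence_rel (flip e).
  by move=> Ee u v w; apply: Ee.
exact: (connect_reach (Ef _ Eb) (Ef _ Ea) xy).
Qed.

Lemma prod_rel_equivalence ea eb : equivalence_rel ea -> equivalence_rel eb ->
  equivalence_rel (fun u v => `[< prod_rel ea eb u v >]).
Proof.
move=> Ea Eb; have csym := sym_connect_sym (step_sym Ea Eb).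
have E u v : `[< prod_rel ea eb u v >] = connect (step ea eb) (inl u) (inl v).
  by apply/asboolP/idP => /prod_relP; apply.
by move=> u v w; rewrite !E connect0; split=> // /(same_connect csym).
Qed.

End Product_relation.

Section Partition_semigroup.
Variable X : finType.

Record CS := MkCS {
  blocks :> {set {set X + X}};
  blocks_partition : partition blocks [set: X + X] }.

HB.instance Definition _ := [isSub for blocks].
HB.instance Definition _ := [Finite of CS by <:].

Definition same_block (a : CS) : rel (X + X) :=
  fun u v => v \in pblock a u.

Lemma same_block_equivalence (a : CS) : equivalence_rel (same_block a).
Proof.
move=> u v w; exact: (pblock_equivalence (blocks_partition a)).
Qed.

Lemma CS_mul_partition (a b : CS) :
  partition (equivalence_partition
    (fun u v => `[< prod_rel (same_block a) (same_block b) u v >])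
    [set: X + X]) [set: X + X].
Proof.
apply: equivalence_partitionP => u v w _ _ _.
by apply: prod_rel_equivalence; apply: same_block_equivalence.
Qed.

Definition CS_mul (a b : CS) : CS := MkCS (CS_mul_partition a b).

HB.instance Definition _ := hasMul.Build CS CS_mul.

Definition IP : {set CS} :=
  [set a : CS | [forall B in blocks a,
     [exists x, inl x \in B] && [exists x, inr x \in B]]].

Definition CS_rank (a : CS) : nat := #|blocks a|.

Definition IP_rank_le (k : nat) : {set CS} := [set a in IP | CS_rank a <= k].

Definition subsemigroup (S : {set CS}) : bool :=
  (S != set0) && [forall a in S, forall b in S, (a * b)%g \in S].

Definition generated_subsemigroup (A : {set CS}) : {set CS} :=
  \bigcap_(S : {set CS} | subsemigroup S && (A \subset S)) S.

Definition maximal_subsemigroup (U S : {set CS}) : bool :=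
  maxset (fun T => subsemigroup T && (T \proper U)) S.

(* U is meant to be an inverse semigroup, in which each a has exactly one
   inverse. *)
Definition inverse_in (U : {set CS}) (a b : CS) : Prop :=
  [/\ b \in U, (a * b * a = a)%g & (b * a * b = b)%g].

Definition inverse_subsemigroup (U S : {set CS}) : Prop :=
  [/\ subsemigroup S, S \subset U
    & forall a b, a \in S -> inverse_in U a b -> b \in S].

Let sumE :
  ((forall x y : X, ((inl x : X + X) == inl y) = (x == y)) *
   (forall x y : X, ((inr x : X + X) == inr y) = (x == y)) *
   (forall x y : X, ((inl x : X + X) == inr y) = false) *
   (forall x y : X, ((inr x : X + X) == inl y) = false))%type.
Proof. by []. Qed.

Lemma perm_CS_partition (g : {perm X}) :
  partition [set [set inl x; inr (g x)] | x : X] [set: X + X].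
Proof.
pose f (u : X + X) := match u with inl x => x | inr y => (g^-1)%g y end.
have := preim_partitionP f [set: X + X]; congr (partition _ _).
have blk u : [set v in [set: X + X] | f u == f v] = [set inl (f u); inr (g (f u))].
  apply/setP=> -[x|y]; rewrite !inE !sumE /= ?orbF.
    by rewrite eq_sym.
  by apply/eqP/eqP => [->|->]; rewrite ?permKV ?permK.
apply/setP=> B; apply/imsetP/imsetP => -[u _ ->]; last first.
  by exists (inl u) => //; rewrite blk.
by exists (f u) => //; rewrite blk.
Qed.

Definition perm_CS (g : {perm X}) : CS := MkCS (perm_CS_partition g).

Lemma tau_partition (x y : X) :
  partition ([set inl x; inl y; inr x; inr y]
             |: [set [set inl z; inr z] | z in ~: [set x; y]]) [set: X + X].
Proof.
pose base (u : X + X) := match u with inl z | inr z => z end.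
pose f u := if base u == y then x else base u.
have := preim_partitionP f [set: X + X]; congr (partition _ _).
have blk1 u : f u = x ->
    [set v in [set: X + X] | f u == f v] = [set inl x; inl y; inr x; inr y].
  move=> ->; apply/setP=> -[z|z]; rewrite !inE !sumE /f /= ?orbF.
    by have [->|_] := eqVneq z y; rewrite ?eqxx ?orbT ?orbF // eq_sym.
  by have [->|_] := eqVneq z y; rewrite ?eqxx ?orbT ?orbF // eq_sym.
have blk2 u : f u != x ->
    [set v in [set: X + X] | f u == f v] = [set inl (base u); inr (base u)].
  rewrite /f; case: ifP => [|uy ux]; first by rewrite eqxx.
  apply/setP=> -[z|z]; rewrite !inE !sumE /= ?orbF;
    by have [->|_] := eqVneq z y; rewrite ?(negbTE ux) 1?eq_sym ?uy.
apply/setP=> B; rewrite inE; apply/imsetP/idP => [[u _ ->]|].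
  have [/blk1->|fux] := eqVneq (f u) x; first by rewrite inE eqxx.
  rewrite (blk2 _ fux); apply/orP; right; apply/imsetP; exists (base u) => //.
  move: fux; rewrite /f !inE; by case: ifP => [|_ /negbTE->] //; rewrite eqxx.
case/orP=> [/set1P->|/imsetP[z]].
  by exists (inl x) => //; rewrite blk1 // /f /=; case: eqP.
rewrite !inE negb_or => /andP[zx zy] ->; exists (inl z) => //.
by rewrite blk2 // /f /= (negbTE zy).
Qed.

Definition tau (x y : X) : CS := MkCS (tau_partition x y).

End Partition_semigroup.

Definition Sym_CS (n : nat) : {set CS 'I_n} := @perm_CS 'I_n @: [set: 'S_n].

(* The points 1 and 2 are the two smallest elements of 'I_n. *)
Definition IT (n : nat) (hn : 1 < n) : {set CS 'I_n} :=
  generated_subsemigroup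
    (tau (Ordinal (ltnW hn)) (Ordinal hn) |: Sym_CS n).

(* Main.v *)
Require Import Defs.
From mathcomp Require Import all_boot all_order all_fingroup all_solvable.
From mathcomp Require Import boolp zify.

(* The key fact is a factorisation: if the block bijection [a] has rank less than
   [n], then splitting off a suitable block [{q, r'}] gives a block bijection [b]
   of rank one more, and [a] is recovered as [b * m] where [m], of rank [n - 1],
   glues the point [r] back. So every element of rank [n - 1] is a permutation
   times some [m], and IP_n is generated by S_n and the elements [m]. Up to
   conjugation by S_n there are two of them: [tau], and a non-uniform one whose
   conjugates also produce [tau].
   The elements of IP_n containing the graph of some permutation form a subsemigroup;
   in rank at least [n - 1] its members are exactly the elements of IT_n, so a
   subsemigroup containing S_n and any other element of rank [n - 1] is all of
   IP_n. A maximal subsemigroup containing S_n is therefore the union of IT_n and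
   I_{n-2}; any other one absorbs the ideal I_{n-1}, and only its subgroup of
   permutations remains to be determined. *)

Set Implicit Arguments.
Unset Strict Implicit.
Unset Printing Implicit Defensive.

(** * Partitions as kernels of labellings, and the product as a pushout *)

Section BlockPartitions.
Variable X : finType.
Implicit Types (a b c : CS X) (u v w : X + X) (x y z : X) (g h : {perm X}).

Lemma sb_refl a u : same_block a u u.
Proof. by have /equivalence_relP[] := same_block_equivalence a. Qed.

Lemma sb_left a u v : same_block a u v -> same_block a u =1 same_block a v.
Proof. by have /equivalence_relP[_] := same_block_equivalence a; apply. Qed.

Lemma sb_sym a u v : same_block a u v = same_block a v u.
Proof. by apply/idP/idP => /sb_left <-; apply: sb_refl. Qed.

Lemma sb_trans a u v w :
  same_block a u v -> same_block a v w -> same_block a u w.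
Proof. by move/sb_left=> ->. Qed.

Lemma pblock_sb a u v : (pblock a u == pblock a v) = same_block a u v.
Proof.
have [covD triv _] := and3P (blocks_partition a).
by rewrite eq_pblock // (eqP covD) inE.
Qed.

Lemma CS_ext a b : same_block a =2 same_block b -> a = b.
Proof.
move=> ab; apply: val_inj => /=.
rewrite -(equivalence_partition_pblock (blocks_partition a)).
rewrite -(equivalence_partition_pblock (blocks_partition b)).
rewrite /equivalence_partition; apply: eq_imset => u.
by apply/setP=> v; rewrite !inE; apply: ab.
Qed.

Lemma sbP a u v :
  reflect (exists2 B, B \in blocks a & (u \in B) && (v \in B)) (same_block a u v).
Proof.
have [covD triv _] := and3P (blocks_partition a).
have cov w : w \in cover a by rewrite (eqP covD) inE.
apply: (iffP idP) => [uv|[B aB /andP[uB vB]]].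
  by exists (pblock a u); rewrite ?pblock_mem // mem_pblock cov.
by rewrite /same_block (def_pblock triv aB uB).
Qed.

Definition kernel_CS (T : finType) (F : X + X -> T) : CS X :=
  MkCS (preim_partitionP F [set: X + X]).

Lemma sb_kernel (T : finType) (F : X + X -> T) u v :
  same_block (kernel_CS F) u v = (F u == F v).
Proof.
rewrite /same_block /= pblock_equivalence_partition ?inE //.
by move=> ? ? ? _ _ _; split=> // /eqP ->.
Qed.

Definition respects (T : Type) a (F : X + X -> T) : Prop :=
  forall u v, same_block a u v -> F u = F v.

(** [F] labels the top and middle copies of [X], [G] the middle and bottom ones; the product sees
    only the top and the bottom. *)
Definition outer (T : Type) (F G : X + X -> T) u : T :=
  match u with inl x => F (inl x) | inr y => G (inr y) end.

Lemma sb_mul a b u v :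
  same_block (a * b)%g u v = `[< prod_rel (same_block a) (same_block b) u v >].
Proof.
rewrite /same_block /= pblock_equivalence_partition ?inE //.
move=> ? ? ? _ _ _; apply: prod_rel_equivalence; exact: same_block_equivalence.
Qed.

(* [a * b] is the pushout of [a] and [b] over the middle copy of [X]: this lemma
   and the next characterise it through labellings of the three copies of [X]. *)
Lemma mul_respects (T : eqType) a b (F G : X + X -> T) :
  (forall x, F (inr x) = G (inl x)) -> respects a F -> respects b G ->
  respects (a * b)%g (outer F G).
Proof.
move=> FG Fa Gb u v; rewrite sb_mul => /asboolP.
move/(prod_relP _ _ (same_block_equivalence a) (same_block_equivalence b)).
(* [L] labels all three copies; being constant along each edge of the graph, it is constant along
   paths. *)
pose L (p : X + X + X) := match p with inl w => outer F G w | inr x => F (inr x) end.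
case/connectP=> p pP vE; suff : L (inl u) = L (inl v) by [].
elim: p (inl u) pP vE => [w _ -> //|q p IHp w /andP[wq qp] vE].
rewrite -(IHp q qp vE) {vE qp IHp}.
case: w q wq => [[x|x]|x] [[y|y]|y]; rewrite /L /outer /= ?orbF ?FG // => wq.
- exact: Fa.
- by rewrite -FG; apply: Fa.
- exact: Gb.
- exact: Gb.
- by rewrite -FG; apply: Fa.
- exact: Gb.
- by case/orP: wq => [/Fa|/Gb //]; rewrite !FG.
Qed.

Lemma mul_labelling a b : exists F G : X + X -> X + X + X,
  [/\ forall x, F (inr x) = G (inl x), respects a F, respects b G
    & forall u v, outer F G u = outer F G v -> same_block (a * b)%g u v].
Proof.
have Ea := same_block_equivalence a; have Eb := same_block_equivalence b.
(* [e] is the edge relation of the three-copy graph, local to the section proving [prod_relP] and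
   hence captured by pattern. Both labellings send a point to the root of its component. *)
have := fun u v => prod_relP u v Ea Eb; set e := (X in connect X) => eP.
have csym : connect_sym e.
  apply: sym_connect_sym => p q; rewrite /e.
  by case: p q => [[x|x]|x] [[y|y]|y] //=; rewrite 1?(sb_sym a) 1?(sb_sym b).
have eE p q : e p q -> root e p = root e q by move/connect1/(rootP csym).
pose F u := root e match u with inl x => inl (inl x) | inr x => inr x end.
pose G u := root e match u with inl x => inr x | inr x => inl (inr x) end.
exists F, G; split=> // [u v uv|u v uv|u v].
- by apply: eE; case: u v uv => [x|x] [y|y]; rewrite /e /= => ->.
- by apply: eE; case: u v uv => [x|x] [y|y]; rewrite /e /= => ->; rewrite ?orbT.
have oE w : outer F G w = root e (inl w) by case: w.
by rewrite !oE => /(rootP csym) uv; rewrite sb_mul; apply/asboolP/eP.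
Qed.
End BlockPartitions.

(** On [D] the map [g] factors through [f], so one image maps onto the other. The factor [h] is
    option-valued because [U] may lack a default element. *)
Lemma leq_card_imset_factor (I T U : finType) (D : {pred I}) (f : I -> T) (g : I -> U) :
  (forall i j, f i = f j -> g i = g j) -> #|g @: D| <= #|f @: D|.
Proof.
move=> fg; pose h t := omap g [pick i in D | f i == t].
rewrite -(card_imset (g @: D) (@Some_inj _ : injective some)).
apply: leq_trans (leq_imset_card h _); apply: subset_leq_card.
apply/subsetP=> _ /imsetP[_ /imsetP[i iD ->] ->].
apply/imsetP; exists (f i); first exact: imset_f.
rewrite /h; case: pickP => [j /andP[_ /eqP /fg /= ->] //|/(_ i)].
by rewrite iD eqxx.
Qed.

(** * Block bijections, their rank, and the permutations among them *)

Section BlockBijections.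
Variable X : finType.
Implicit Types (a b c : CS X) (u v w : X + X) (x y z : X) (g h : {perm X}).

Lemma mul_upper a b x y :
  same_block a (inl x) (inl y) -> same_block (a * b)%g (inl x) (inl y).
Proof. by move=> xy; have [F [G [_ Fa _]]] := mul_labelling a b; apply; apply: Fa. Qed.

Lemma mul_lower a b x y :
  same_block b (inr x) (inr y) -> same_block (a * b)%g (inr x) (inr y).
Proof. by move=> xy; have [F [G [_ _ Gb]]] := mul_labelling a b; apply; apply: Gb. Qed.

Lemma mul_mixed a b x y z : same_block a (inl x) (inr y) ->
  same_block b (inl y) (inr z) -> same_block (a * b)%g (inl x) (inr z).
Proof.
move=> xy yz; have [F [G [FG Fa Gb]]] := mul_labelling a b; apply=> /=.
by rewrite (Fa _ _ xy) FG (Gb _ _ yz).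
Qed.

Lemma mul_upper_via a b x y z t : same_block a (inl x) (inr z) ->
  same_block b (inl z) (inl t) -> same_block a (inl y) (inr t) ->
  same_block (a * b)%g (inl x) (inl y).
Proof.
move=> xz zt yt; have [F [G [FG Fa Gb]]] := mul_labelling a b; apply=> /=.
by rewrite (Fa _ _ xz) FG (Gb _ _ zt) -FG -(Fa _ _ yt).
Qed.

Lemma IP_P a :
  reflect ((forall x, exists y, same_block a (inl x) (inr y)) /\
           (forall y, exists x, same_block a (inl x) (inr y)))
          (a \in IP X).
Proof.
have [covD triv nz] := and3P (blocks_partition a).
have cov w : w \in cover a by rewrite (eqP covD) inE.
rewrite inE; apply: (iffP forall_inP) => [H|[Hl Hr] B aB].
  split=> [x|y].
    have /H /andP[_ /existsP[y]] : pblock a (inl x) \in blocks a by apply: pblock_mem.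
    by exists y.
  have /H /andP[/existsP[x xy] _] : pblock a (inr y) \in blocks a by apply: pblock_mem.
  by exists x; rewrite sb_sym.
have [E|[u uB]] := set_0Vmem B; first by rewrite E (negbTE nz) in aB.
have mem v : same_block a u v -> v \in B.
  by rewrite /same_block (def_pblock triv aB uB).
case: u uB mem => [x|y] uB mem.
  have [y xy] := Hl x.
  by apply/andP; split; apply/existsP; [exists x|exists y; apply: mem].
have [x xy] := Hr y.
apply/andP; split; apply/existsP; last by exists y.
by exists x; apply: mem; rewrite sb_sym.
Qed.

(** Two points of the same copy are related through a point of the other copy in their block, so an
    inclusion need only be tested on mixed pairs. *)
Lemma IP_subrel a c : a \in IP X ->
  (forall x y, same_block a (inl x) (inr y) -> same_block c (inl x) (inr y)) ->
  forall u v, same_block a u v -> same_block c u v.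
Proof.
case/IP_P=> al ar ac [x|x] [y|y]; [|exact: ac|by rewrite ![_ (inr x) _]sb_sym; apply: ac|].
- move=> xy; have [z yz] := al y.
  apply: sb_trans (ac x z (sb_trans xy yz)) _.
  by rewrite sb_sym ac.
- move=> xy; have [z zx] := ar x.
  apply: sb_trans (ac z y (sb_trans zx xy)).
  by rewrite sb_sym ac.
Qed.

Lemma IP_mul a b : a \in IP X -> b \in IP X -> (a * b)%g \in IP X.
Proof.
move=> /IP_P[al ar] /IP_P[bl br]; apply/IP_P; split=> [x|y].
  have [z xz] := al x; have [y zy] := bl z.
  by exists y; apply: mul_mixed xz zy.
have [z zy] := br y; have [x xz] := ar z.
by exists x; apply: mul_mixed xz zy.
Qed.

Lemma CS_rankE a : CS_rank a = #|[set pblock a u | u : X + X]|.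
Proof.
have [covD triv nz] := and3P (blocks_partition a).
rewrite /CS_rank; congr #|pred_of_set _|; apply/setP=> B; apply/idP/imsetP.
  move=> aB; have [E|[u uB]] := set_0Vmem B; first by rewrite E (negbTE nz) in aB.
  by exists u; rewrite ?(def_pblock triv aB uB).
by case=> u _ ->; apply: pblock_mem; rewrite (eqP covD) inE.
Qed.

Lemma rank_upperE a : a \in IP X ->
  CS_rank a = #|[set pblock a (inl x) | x : X]|.
Proof.
case/IP_P=> al ar; rewrite CS_rankE; congr #|pred_of_set _|.
apply/setP=> B; apply/imsetP/imsetP => [[[x|y] _ ->]|[x _ ->]].
- by exists x.
- by have [x xy] := ar y; exists x => //; apply/eqP; rewrite pblock_sb sb_sym.
- by exists (inl x).
Qed.

Lemma rank_lowerE a : a \in IP X ->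
  CS_rank a = #|[set pblock a (inr x) | x : X]|.
Proof.
case/IP_P=> al ar; rewrite CS_rankE; congr #|pred_of_set _|.
apply/setP=> B; apply/imsetP/imsetP => [[[x|y] _ ->]|[x _ ->]].
- by have [y xy] := al x; exists y => //; apply/eqP; rewrite pblock_sb.
- by exists y.
- by exists (inr x).
Qed.

Lemma rank_leq a : a \in IP X -> CS_rank a <= #|X|.
Proof. by move=> aI; rewrite rank_upperE // leq_imset_card. Qed.

(** Multiplying on the right can only coarsen the partition that [a] induces on the upper points,
    and these meet every block. *)
Lemma rank_mul_l a b : a \in IP X -> b \in IP X -> CS_rank (a * b)%g <= CS_rank a.
Proof.
move=> aI bI; rewrite !rank_upperE ?IP_mul //.
apply: leq_card_imset_factor => x y /eqP; rewrite pblock_sb => xy.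
by apply/eqP; rewrite pblock_sb mul_upper.
Qed.

Lemma rank_mul_r a b : a \in IP X -> b \in IP X -> CS_rank (a * b)%g <= CS_rank b.
Proof.
move=> aI bI; rewrite !rank_lowerE ?IP_mul //.
apply: leq_card_imset_factor => x y /eqP; rewrite pblock_sb => xy.
by apply/eqP; rewrite pblock_sb mul_lower.
Qed.

Lemma sb_perm g u v : same_block (perm_CS g) u v =
  (match u with inl x => g x | inr y => y end ==
   match v with inl x => g x | inr y => y end).
Proof.
pose f w := match w with inl x => g x | inr y => y end.
rewrite -/(f u) -/(f v); have blk w z : (w \in [set inl z; inr (g z)]) = (f w == g z).
  rewrite !inE; case: w => [x|y] /=; first by rewrite (inj_eq perm_inj) orbF.
  by [].
apply/sbP/eqP => [[B /imsetP[z _ ->]]|uv].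
  by rewrite !blk => /andP[/eqP-> /eqP->].
exists [set inl (g^-1%g (f u)); inr (g (g^-1%g (f u)))]; first exact: imset_f.
by rewrite !blk permKV uv eqxx.
Qed.

Lemma perm_mul_sb g a u v :
  let f w := match w with inl x => inl (g x) | inr y => inr y end in
  same_block (perm_CS g * a)%g u v = same_block a (f u) (f v).
Proof.
move=> f; apply/idP/idP.
  pose F w := pblock a (inl match w with inl x => g x | inr y => y end).
  have Fg : respects (perm_CS g) F.
    by move=> [x|x] [y|y]; rewrite sb_perm => /eqP E; congr (pblock a (inl _)).
  have Ga : respects a (pblock a) by move=> w z wz; apply/eqP; rewrite pblock_sb.
  have FG z : F (inr z) = pblock a (inl z) by [].
  move/(mul_respects FG Fg Ga) => E; rewrite -pblock_sb; apply/eqP.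
  by case: u v E => [x|x] [y|y].
have [F [G [FG Fg Ga FGo]]] := mul_labelling (perm_CS g) a => uv; apply: FGo.
suff E w : outer F G w = G (f w) by rewrite !E; apply: Ga.
case: w => [x|//] /=; rewrite -FG; apply: Fg; by rewrite sb_perm.
Qed.

Lemma mul_perm_sb g a u v :
  let f w := match w with inl x => inl x | inr y => inr (g^-1%g y) end in
  same_block (a * perm_CS g)%g u v = same_block a (f u) (f v).
Proof.
move=> f; apply/idP/idP.
  pose G w := pblock a (inr match w with inl x => x | inr y => g^-1%g y end).
  have Gg : respects (perm_CS g) G.
    move=> [x|x] [y|y]; rewrite sb_perm => /eqP.
    - by move/perm_inj->.
    - by move=> <-; rewrite /G permK.
    - by move=> ->; rewrite /G permK.
    - by move->.
  have Fa : respects a (pblock a) by move=> w z wz; apply/eqP; rewrite pblock_sb.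
  have FG z : pblock a (inr z) = G (inl z) by [].
  move/(mul_respects FG Fa Gg) => E; rewrite -pblock_sb; apply/eqP.
  by case: u v E => [x|x] [y|y].
have [F [G [FG Fa Gg FGo]]] := mul_labelling a (perm_CS g) => uv; apply: FGo.
suff E w : outer F G w = F (f w) by rewrite !E; apply: Fa.
case: w => [//|y] /=; rewrite FG; apply: Gg; by rewrite sb_perm permKV.
Qed.

Lemma perm_CS_M g h : (perm_CS g * perm_CS h)%g = perm_CS (g * h)%g.
Proof.
apply: CS_ext => u v; rewrite perm_mul_sb !sb_perm.
by case: u v => [x|x] [y|y]; rewrite ?permM.
Qed.

Lemma perm_CSK g a : (perm_CS g^-1 * (perm_CS g * a) = a)%g.
Proof.
apply: CS_ext => u v; rewrite !perm_mul_sb.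
by case: u v => [x|x] [y|y]; rewrite ?permKV.
Qed.

Lemma perm_CS_inj : injective (@perm_CS X).
Proof.
move=> g h gh; apply/permP=> x; apply/eqP.
by have := sb_perm h (inl x) (inr (g x)); rewrite -gh sb_perm eqxx => /esym; rewrite eq_sym.
Qed.

Lemma perm_CS_IP g : perm_CS g \in IP X.
Proof.
apply/IP_P; split=> [x|y]; first by exists (g x); rewrite sb_perm.
by exists (g^-1%g y); rewrite sb_perm permKV.
Qed.

Lemma rank_perm g : CS_rank (perm_CS g) = #|X|.
Proof.
rewrite rank_upperE ?perm_CS_IP // card_imset // => x y /eqP.
by rewrite pblock_sb sb_perm => /eqP/perm_inj.
Qed.

(** With as many blocks as points, no block has two upper or two lower points, so each block is a
    pair. *)
Lemma rank_max_perm a : a \in IP X -> #|X| <= CS_rank a ->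
  exists g, a = perm_CS g.
Proof.
move=> aI ra; have [al ar] := IP_P a aI.
have injl x y : same_block a (inl x) (inl y) -> x = y.
  rewrite -pblock_sb => /eqP.
  have /imset_injP H : #|[set pblock a (inl x) | x : X]| == #|X|.
    by rewrite -rank_upperE // eqn_leq rank_leq.
  by apply: H.
have injr x y : same_block a (inr x) (inr y) -> x = y.
  rewrite -pblock_sb => /eqP.
  have /imset_injP H : #|[set pblock a (inr x) | x : X]| == #|X|.
    by rewrite -rank_lowerE // eqn_leq rank_leq.
  by apply: H.
have [f fP] := fin_all_exists al.
have finj : injective f.
  move=> x y E; apply: injl; apply: sb_trans (fP x) _.
  by rewrite E sb_sym.
exists (perm finj); apply: CS_ext => u v; apply/idP/idP.
  apply: IP_subrel => // x y xy; rewrite sb_perm permE.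
  by apply/eqP/injr; apply: sb_trans xy; rewrite sb_sym.
apply: IP_subrel; first exact: perm_CS_IP.
by move=> x y; rewrite sb_perm permE => /eqP <-.
Qed.

End BlockBijections.

(** * Merges, factorisation by rank, and elements containing a permutation *)

Section Generation.
Variable X : finType.
Implicit Types (a b c : CS X) (u v w : X + X) (x y z p r s : X) (g h : {perm X}).

(** Transitivity on tuples of distinct points; it serves to conjugate one merge into another. *)
Lemma perm_map_seq (s t : seq X) :
  uniq s -> uniq t -> size s = size t -> exists g : {perm X}, map g s = t.
Proof.
elim: s t => [|x s IHs] [|y t] //=; first by exists 1%g.
case/andP=> xs us /andP[yt ut] [st]; have [g gst] := IHs t us ut st.
(* The transposition corrects the image of [x] and fixes [t] pointwise, since neither [g x] nor [y]
   lies in [t]. *)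
exists (g * tperm (g x) y)%g; rewrite permM tpermL; congr (_ :: _).
rewrite -[RHS]gst; apply/eq_in_map => z zs; rewrite permM tpermD //.
  by apply: contra xs => /eqP/perm_inj->.
by apply: contra yt => /eqP->; rewrite -gst map_f.
Qed.

Definition collapse r p z := if z == r then p else z.

Lemma collapse_id r p z : z != r -> collapse r p z = z.
Proof. by rewrite /collapse => /negbTE->. Qed.

Lemma collapse_r r p : collapse r p r = p.
Proof. by rewrite /collapse eqxx. Qed.

Lemma collapse_neq r p z : p != r -> collapse r p z != r.
Proof. by rewrite /collapse; case: ifP => // ->. Qed.

Lemma collapse_perm g r p z : g (collapse r p z) = collapse (g r) (g p) (g z).
Proof. by rewrite /collapse (inj_eq perm_inj); case: ifP. Qed.

Definition merge_label r p s u :=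
  match u with inl z => collapse r p z | inr z => collapse r s z end.

(* For [p = s] the only nontrivial block is [{p, r, p', r'}]; otherwise the two
   nontrivial blocks are [{p, r, p'}] and [{s, s', r'}]. *)
Definition merge_CS r p s : CS X := kernel_CS (merge_label r p s).

Lemma sb_merge r p s u v :
  same_block (merge_CS r p s) u v = (merge_label r p s u == merge_label r p s v).
Proof. exact: sb_kernel. Qed.

Lemma merge_IP r p s : p != r -> s != r -> merge_CS r p s \in IP X.
Proof.
move=> pr sr; apply/IP_P; split=> x.
  by exists (collapse r p x); rewrite sb_merge /= (@collapse_id r s) ?collapse_neq.
exists (collapse r s x).
by rewrite sb_merge /= (@collapse_id r p) ?collapse_neq.
Qed.

(** The upper points other than [r] keep distinct labels. *)
Lemma rank_merge r p s : p != r -> s != r -> #|X|.-1 <= CS_rank (merge_CS r p s).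
Proof.
move=> pr sr; rewrite rank_upperE ?merge_IP // -(cardC1 r).
rewrite -(@card_in_imset _ _ (fun x => pblock (merge_CS r p s) (inl x))).
  apply: subset_leq_card; apply/subsetP=> _ /imsetP[x _ ->]; exact: imset_f.
move=> x y; rewrite !inE => xr yr /eqP.
by rewrite pblock_sb sb_merge /= !collapse_id // => /eqP.
Qed.

Lemma merge_conj g r p s :
  (perm_CS g^-1 * merge_CS r p s * perm_CS g)%g = merge_CS (g r) (g p) (g s).
Proof.
apply: CS_ext => u v; rewrite mul_perm_sb perm_mul_sb !sb_merge.
rewrite -(inj_eq (@perm_inj _ g)).
by case: u v => [x|x] [y|y]; rewrite /= !collapse_perm !permKV.
Qed.

(** The labellings of both factors restrict to [collapse r s] on the middle copy, so they glue to
    one that is [collapse r p] on both outer copies. This produces [tau] from non-uniform merges. *)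
Lemma merge_mul r p s : p != r -> s != r -> p != s ->
  (merge_CS r p s * merge_CS r s p)%g = merge_CS r p p.
Proof.
move=> pr sr ps; apply: CS_ext => u v; apply/idP/idP.
  pose F := merge_label r p s; pose G := merge_label r s p.
  have FG z : F (inr z) = G (inl z) by [].
  have Fr : respects (merge_CS r p s) F by move=> ? ?; rewrite sb_merge => /eqP.
  have Gr : respects (merge_CS r s p) G by move=> ? ?; rewrite sb_merge => /eqP.
  move/(mul_respects FG Fr Gr) => E; rewrite sb_merge; apply/eqP.
  by case: u v E => [x|x] [y|y].
apply: IP_subrel; first exact: merge_IP.
move=> x y; rewrite sb_merge => /eqP /= xy.
apply: (@mul_mixed _ _ _ _ (collapse r p x)); rewrite sb_merge /=.
  by rewrite (@collapse_id r s) ?collapse_neq.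
by rewrite xy (@collapse_id r s) ?collapse_neq.
Qed.

(* Choose [q != q2] in one block and [r', s'] with [r != s] in one block; [b] is
   [a] with [q2] and [r'] split off to form a new block. *)
Lemma rank_lt_decomp a : a \in IP X -> CS_rank a < #|X| ->
  exists b r p s, [/\ b \in IP X, CS_rank a < CS_rank b, p != r, s != r
                    & a = (b * merge_CS r p s)%g].
Proof.
move=> aI ra; have [al ar] := IP_P a aI.
have [q [q2 [qq2 qB]]] : exists q q2, q != q2 /\ same_block a (inl q) (inl q2).
  have [/injectiveP inj|/injectivePn[q [q2 qq2 /eqP E]]] :=
    boolP (injectiveb (fun x => pblock a (inl x))).
    by move: ra; rewrite rank_upperE // card_imset // ltnn.
  by exists q, q2; rewrite -pblock_sb.
have [s [r [sr sB]]] : exists s r, s != r /\ same_block a (inr s) (inr r).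
  have [/injectiveP inj|/injectivePn[s [r sr /eqP E]]] :=
    boolP (injectiveb (fun x => pblock a (inr x))).
    by move: ra; rewrite rank_lowerE // card_imset // ltnn.
  by exists s, r; rewrite -pblock_sb.
have avoid x : exists2 y, y != r & same_block a (inl x) (inr y).
  have [y xy] := al x; have [E|ne] := eqVneq y r; last by exists y.
  by exists s => //; apply: sb_trans xy _; rewrite E sb_sym.
have avoid' y : exists2 x, x != q2 & same_block a (inl x) (inr y).
  have [x xy] := ar y; have [E|ne] := eqVneq x q2; last by exists x.
  by exists q => //; apply: sb_trans qB _; rewrite -E.
have [p pr qp] := avoid q.
(* [None] is the label of the new block; all other points keep their block of [a]. *)
pose L u := if (u == inl q2) || (u == inr r) then None else Some (pblock a u).
have Ll x : L (inl x) = if x == q2 then None else Some (pblock a (inl x)).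
  by rewrite /L orbF.
have Lr x : L (inr x) = if x == r then None else Some (pblock a (inr x)) by [].
pose b := kernel_CS L.
have bmix x y : x != q2 -> y != r ->
    same_block a (inl x) (inr y) -> same_block b (inl x) (inr y).
  move=> /negbTE x2 /negbTE yr xy; rewrite sb_kernel Ll Lr x2 yr.
  by apply/eqP; congr Some; apply/eqP; rewrite pblock_sb.
have bnew : same_block b (inl q2) (inr r) by rewrite sb_kernel Ll Lr !eqxx.
exists b, r, p, s; split=> //.
- apply/IP_P; split=> x.
    have [->|x2] := eqVneq x q2; first by exists r.
    by have [y yr xy] := avoid x; exists y; apply: bmix.
  have [->|xr] := eqVneq x r; first by exists q2.
  by have [y yq yx] := avoid' x; exists y; apply: bmix.
- rewrite !CS_rankE.
  (* Every block of [a] survives as a label, through [q] or [s] if its point was split off, and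
     [None] is one label more. *)
  suff H : #|[set pblock a u | u : X + X]| < #|[set L u | u : X + X]|.
    apply: leq_trans H _; apply: leq_card_imset_factor => u v /eqP.
    by rewrite pblock_sb sb_kernel => /eqP.
  rewrite -(card_imset _ (@Some_inj _ : injective some)).
  apply: (@leq_trans #|None |: Some @: [set pblock a u | u : X + X]|).
    rewrite cardsU1 -[X in X < _]add0n ltn_add2r.
    by case: imsetP => // -[? _].
  apply: subset_leq_card; apply/subsetP=> o /setU1P[->|/imsetP[_ /imsetP[u _ ->] ->]].
    by apply/imsetP; exists (inr r); rewrite // Lr eqxx.
  apply/imsetP; case: u => [x|y].
    have [->|/negbTE x2] := eqVneq x q2; last by exists (inl x); rewrite ?Ll ?x2.
    exists (inl q); rewrite // Ll (negbTE qq2); congr Some.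
    by apply/eqP; rewrite pblock_sb sb_sym.
  have [->|/negbTE x2] := eqVneq y r; last by exists (inr y); rewrite ?Lr ?x2.
  exists (inr s); rewrite // Lr (negbTE sr); congr Some.
  by apply/eqP; rewrite pblock_sb sb_sym.
apply: CS_ext => u v; apply/idP/idP.
  apply: IP_subrel => // x y xy.
  (* The merge ties the middle points [r] and [p], hence [q2] to [q], and the bottom points [r] and
     [s]. So [x] and [y] can be moved away from [q2] and [r] without changing their labels. *)
  have [F [G [FG Fb Gm]]] := mul_labelling b (merge_CS r p s); apply=> /=.
  have Gl : G (inr r) = G (inr s).
    by apply: Gm; rewrite sb_merge /= collapse_r collapse_id.
  have Gmid z : z != r -> G (inl z) = G (inr z).
    by move=> zr; apply: Gm; rewrite sb_merge /= !collapse_id.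
  have Fq : F (inl q2) = F (inl q).
    rewrite (Fb _ _ bnew) FG (Fb _ _ (bmix _ _ qq2 pr qp)) FG.
    by apply: Gm; rewrite sb_merge /= collapse_r collapse_id.
  have [x0 [x02 -> x0x]] : exists x0,
      [/\ x0 != q2, F (inl x) = F (inl x0) & same_block a (inl x0) (inl x)].
    have [->|x2] := eqVneq x q2; last by exists x; split=> //; apply: sb_refl.
    by exists q.
  have [y0 [y0r -> yy0]] : exists y0,
      [/\ y0 != r, G (inr y) = G (inr y0) & same_block a (inr y) (inr y0)].
    have [->|yr] := eqVneq y r; last by exists y; split=> //; apply: sb_refl.
    by exists s; split=> //; rewrite sb_sym.
  rewrite -Gmid // -FG; apply: Fb; apply: bmix => //.
  exact: sb_trans x0x (sb_trans xy yy0).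
have E w1 w2 : same_block a w1 w2 -> pblock a w1 = pblock a w2 by rewrite -pblock_sb => /eqP.
(* Conversely, label by blocks of [a]. The middle point [r] gets the block of [q], which contains
   both [q2] above it and the lower point [p] it is merged with. *)
pose F (w : X + X) := match w with inl x => pblock a (inl x)
  | inr y => if y == r then pblock a (inl q) else pblock a (inr y) end.
pose G (w : X + X) := match w with inl y => F (inr y) | inr y => pblock a (inr y) end.
have FG z : F (inr z) = G (inl z) by [].
have Fb : respects b F.
  have FL w : F w = odflt (pblock a (inl q)) (L w).
    case: w => x; rewrite ?Ll ?Lr /=; case: eqP => //= ->.
    by apply: E; rewrite sb_sym.
  by move=> w z; rewrite sb_kernel => /eqP E'; rewrite !FL E'.
have Gm : respects (merge_CS r p s) G.
  have GL w : G w = pblock a (inr (merge_label r p s w)).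
    case: w => x; rewrite /= /collapse; case: eqP => // xr; apply: E => //.
    by rewrite xr sb_sym.
  by move=> w z; rewrite sb_merge => /eqP E'; rewrite !GL E'.
move/(mul_respects FG Fb Gm) => E'; rewrite -pblock_sb; apply/eqP.
by case: u v E' => [x|x] [y|y].
Qed.

(** A single splitting raises the rank to [#|X|], so the left factor is a permutation. *)
Lemma corank1_decomp a : a \in IP X -> #|X|.-1 <= CS_rank a ->
  (exists g, a = perm_CS g) \/
  (exists g r p s, [/\ p != r, s != r & a = (perm_CS g * merge_CS r p s)%g]).
Proof.
move=> aI ra; have [lt|ge] := ltnP (CS_rank a) #|X|; last first.
  by left; apply: rank_max_perm.
have [b [r [p [s [bI rb pr sr E]]]]] := rank_lt_decomp aI lt.
have [|g gE] := rank_max_perm bI; first by lia.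
by right; exists g, r, p, s; rewrite -gE.
Qed.

Lemma subsemigroupP (S : {set CS X}) :
  reflect (S != set0 /\ (forall a b, a \in S -> b \in S -> (a * b)%g \in S))
          (subsemigroup S).
Proof.
apply: (iffP andP) => -[S0 H]; split=> //.
  by move=> a b aS bS; move/forall_inP/(_ a aS)/forall_inP/(_ b bS): H.
by apply/forall_inP=> a aS; apply/forall_inP=> b bS; apply: H.
Qed.

(** Induction on the defect [#|X| - CS_rank a]: merges are peeled off one at a time until a
    permutation remains. *)
Lemma IP_sub_of_merge (S : {set CS X}) : subsemigroup S ->
    (forall g, perm_CS g \in S) ->
    (forall r p s, p != r -> s != r -> merge_CS r p s \in S) ->
  IP X \subset S.
Proof.
case/subsemigroupP=> _ SM Sp Sm; apply/subsetP=> a.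
have [k] := ubnP (#|X| - CS_rank a); elim: k a => // k IHk a ka aI.
have [lt|ge] := ltnP (CS_rank a) #|X|; last first.
  by have [g ->] := rank_max_perm aI ge.
have [b [r [p [s [bI rb pr sr ->]]]]] := rank_lt_decomp aI lt.
by apply: SM; [apply: IHk => //; lia|apply: Sm].
Qed.

(** These are the uniform block bijections: each block has as many upper as lower points. *)
Definition above_perm : {set CS X} :=
  [set a | [exists g : {perm X}, forall x, same_block a (inl x) (inr (g x))]].

Lemma above_permP a :
  reflect (exists g, forall x, same_block a (inl x) (inr (g x))) (a \in above_perm).
Proof. by rewrite inE; apply: (iffP existsP) => -[g /forallP]; exists g => //; apply/forallP. Qed.

Lemma above_perm_perm g : perm_CS g \in above_perm.
Proof. by apply/above_permP; exists g => x; rewrite sb_perm. Qed.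

Lemma above_perm_merge r p : merge_CS r p p \in above_perm.
Proof. by apply/above_permP; exists 1%g => x; rewrite sb_merge perm1. Qed.

Lemma above_perm_mul a b :
  a \in above_perm -> b \in above_perm -> (a * b)%g \in above_perm.
Proof.
move=> /above_permP[g ag] /above_permP[h bh]; apply/above_permP.
by exists (g * h)%g => x; rewrite permM; apply: mul_mixed (bh _).
Qed.

(** The upper points [p] and [r] share a block whose only lower point is [p], so a permutation
    inside it would send both to [p]. *)
Lemma merge_not_above r p s : p != r -> s != r -> p != s ->
  merge_CS r p s \notin above_perm.
Proof.
move=> pr sr ps; apply/above_permP => -[g gP].
have gp z : collapse r p z = p -> g z = p.
  move=> zp; have := gP z; rewrite sb_merge /= zp /collapse.
  by case: (g z == r) => /eqP // E; rewrite E eqxx in ps.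
have : g p = g r by rewrite !gp ?collapse_r ?collapse_id.
by move/perm_inj/eqP; rewrite (negbTE pr).
Qed.

Lemma perm_merge_above g r p s : p != r -> s != r ->
  ((perm_CS g * merge_CS r p s)%g \in above_perm) = (p == s).
Proof.
move=> pr sr; apply/idP/eqP => [|->].
  move/(above_perm_mul (above_perm_perm g^-1)); rewrite perm_CSK.
  by apply: contraTeq => ps; apply: merge_not_above.
by rewrite above_perm_mul ?above_perm_perm ?above_perm_merge.
Qed.

Lemma subsemigroup_eq_IP (S : {set CS X}) a : subsemigroup S -> S \subset IP X ->
  (forall g, perm_CS g \in S) ->
  a \in S -> a \notin above_perm -> #|X|.-1 <= CS_rank a -> S = IP X.
Proof.
move=> subS SI Sp aS aF ra; apply/eqP; rewrite eqEsubset SI /=.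
have [S0 SM] := subsemigroupP _ subS.
have aI := subsetP SI _ aS.
have [[g E]|[g [r0 [p0 [s0 [pr sr E]]]]]] := corank1_decomp aI ra.
  by rewrite E above_perm_perm in aF.
move: aF; rewrite E perm_merge_above // => ps.
(* Cancelling [g] leaves a merge on three distinct points; conjugation then yields every such
   merge. *)
have m0 : merge_CS r0 p0 s0 \in S.
  by rewrite -(perm_CSK g (merge_CS r0 p0 s0)) -E SM.
have conj g' r p s : merge_CS r p s \in S -> merge_CS (g' r) (g' p) (g' s) \in S.
  by move=> mS; rewrite -merge_conj !SM.
have m3 r p s : uniq [:: r; p; s] -> merge_CS r p s \in S.
  move=> U; have [||//|g' [<- <- <-]] := @perm_map_seq [:: r0; p0; s0] [:: r; p; s] => //.
    by rewrite /= !inE ![r0 == _]eq_sym negb_or pr sr ps.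
  exact: conj.
apply: IP_sub_of_merge => // r p s npr nsr.
have [E'|nps] := eqVneq p s; last first.
  by apply: m3; rewrite /= !inE ![r == _]eq_sym negb_or npr nsr nps.
(* A uniform merge is conjugate to the one on [r0] and [p0], which is a product of two non-uniform
   merges with third point [s0]. *)
rewrite -E'; have [||//|g' [<- <-]] := @perm_map_seq [:: r0; p0] [:: r; p] => //.
- by rewrite /= !inE eq_sym pr.
- by rewrite /= !inE eq_sym npr.
apply: conj; rewrite -(merge_mul pr sr ps); apply: SM => //.
by apply: m3; rewrite /= !inE ![r0 == _]eq_sym negb_or pr sr eq_sym ps.
Qed.

(** The two equations of [inverse_in] suffice: [bab] shows that upper points related by [a] are
    related as lower points by [b], and [aba] locates a partner of [h x] in [b]. *)
Lemma above_perm_inverse a b h : inverse_in (IP X) a b ->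
  (forall x, same_block a (inl x) (inr (h x))) ->
  forall x, same_block b (inl (h x)) (inr x).
Proof.
case=> bI aba bab ah x; have [bl br] := IP_P b bI.
have ker_sub y z : same_block a (inl y) (inl z) -> same_block b (inr y) (inr z).
  have [y' by'] := br y; have [z' bz'] := br z => yz.
  have yz' : same_block b (inl y') (inl z').
    by rewrite -bab; apply/mul_upper/(mul_upper_via by' yz bz').
  by rewrite sb_sym in by'; apply: sb_trans by' (sb_trans yz' bz').
have [z hz] := bl (h x).
(* Thus [x] and [z] both lie in the block of the lower point [h z] in [a], and [ker_sub] applies to
   them. *)
have xz : same_block a (inl x) (inr (h z)).
  by rewrite -[in X in same_block X]aba; apply: mul_mixed (mul_mixed (ah x) hz) (ah z).
apply: sb_trans hz (ker_sub _ _ _); apply: sb_trans (ah z) _.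
by rewrite sb_sym.
Qed.

Lemma sb_tau x y u v : x != y ->
  same_block (tau x y) u v = same_block (merge_CS y x x) u v.
Proof.
move=> xy; rewrite sb_merge; set f := merge_label y x x.
have blk1 w : (w \in [set inl x; inl y; inr x; inr y]) = (f w == x).
  rewrite !inE; case: w => z; rewrite /f /= /collapse ?orbF;
    case: (eqVneq z y) => [->|zy]; rewrite ?eqxx ?orbT ?orbF //.
  - by rewrite -[inl z == inl y]/(z == y) (negbTE zy) orbF.
  - by rewrite -[inr z == inr y]/(z == y) (negbTE zy) orbF.
have blk2 w z : z != x -> z != y -> (w \in [set inl z; inr z]) = (f w == z).
  move=> zx zy; rewrite !inE; case: w => t; rewrite /f /= /collapse ?orbF;
    case: (eqVneq t y) => [->|//];
    by change ((y == z) = (x == z)); rewrite ![_ == z]eq_sym (negbTE zx) (negbTE zy).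
apply/sbP/eqP => [[B /setU1P[->|/imsetP[z]]]|uv].
- by rewrite !blk1 => /andP[/eqP-> /eqP->].
- rewrite !inE negb_or => /andP[zx zy] ->.
  by rewrite !blk2 // => /andP[/eqP-> /eqP->].
have [fx|fx] := eqVneq (f u) x.
  by exists [set inl x; inl y; inr x; inr y]; rewrite ?setU11 // !blk1 -uv fx eqxx.
have fy : f u != y by rewrite /f; case: (u) => z /=; apply: collapse_neq.
exists [set inl (f u); inr (f u)]; last by rewrite !blk2 // uv eqxx.
apply/setU1P; right; apply/imsetP; exists (f u) => //.
by rewrite !inE negb_or fx.
Qed.

Lemma tau_merge x y : x != y -> tau x y = merge_CS y x x.
Proof. by move=> xy; apply: CS_ext => u v; apply: sb_tau. Qed.

End Generation.

(** * Generated subsemigroups, rank ideals, and inverses *)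

Section Ideals.
Variable X : finType.
Implicit Types (a b c : CS X) (S A H : {set CS X}).

Lemma sub_generated A : A \subset generated_subsemigroup A.
Proof. by apply/bigcapsP => S /andP[]. Qed.

Lemma generated_min A S : subsemigroup S -> A \subset S ->
  generated_subsemigroup A \subset S.
Proof. by move=> sS AS; apply: bigcap_inf; rewrite sS. Qed.

Lemma generated_mul A a b :
  a \in generated_subsemigroup A -> b \in generated_subsemigroup A ->
  (a * b)%g \in generated_subsemigroup A.
Proof.
move=> /bigcapP aG /bigcapP bG; apply/bigcapP => S SA.
have /andP[/subsemigroupP[_ SM] _] := SA.
by apply: SM; [apply: aG|apply: bG].
Qed.

Lemma rank_leP k a : reflect (a \in IP X /\ CS_rank a <= k) (a \in IP_rank_le X k).
Proof. by rewrite /IP_rank_le [a \in [set _ in _ | _]]in_set; apply: andP. Qed.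

(** Rank never grows in a product, so only products of two elements of [H] remain to be checked. *)
Lemma subsemigroup_setU_ideal H k : H != set0 -> H \subset IP X ->
  (forall a b, a \in H -> b \in H -> (a * b)%g \in H :|: IP_rank_le X k) ->
  subsemigroup (H :|: IP_rank_le X k).
Proof.
move=> H0 HI HM; apply/subsemigroupP; split.
  by apply: contraNneq H0 => E; rewrite -subset0 -E subsetUl.
have IPh a : a \in H :|: IP_rank_le X k -> a \in IP X.
  by case/setUP=> [/(subsetP HI)|/rank_leP[]].
move=> a b aH bH; have [aI bI] := (IPh a aH, IPh b bH).
case/setUP: (aH) => [aH'|/rank_leP[_ ra]]; last first.
  by apply/setUP; right; apply/rank_leP; rewrite IP_mul // (leq_trans (rank_mul_l _ _)).
case/setUP: bH => [bH'|/rank_leP[_ rb]]; last first.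
  by apply/setUP; right; apply/rank_leP; rewrite IP_mul // (leq_trans (rank_mul_r _ _)).
exact: HM.
Qed.

Lemma rank_inverse a b : a \in IP X -> inverse_in (IP X) a b -> CS_rank b <= CS_rank a.
Proof.
move=> aI [bI _ bab]; rewrite -[in X in X <= _]bab.
exact: leq_trans (rank_mul_l (IP_mul bI aI) bI) (rank_mul_r bI aI).
Qed.

(** The equation [gbg = g] forces [b] to have full rank, hence to be a permutation, and
    [above_perm_inverse] identifies it. *)
Lemma perm_inverse g b : inverse_in (IP X) (perm_CS g) b -> b = perm_CS g^-1.
Proof.
move=> inv; have [bI gbg _] := inv.
have [|k bE] := rank_max_perm bI.
  rewrite -(rank_perm g) -[in X in X <= _]gbg.
  have gI := perm_CS_IP g.
  exact: leq_trans (rank_mul_l (IP_mul gI bI) gI) (rank_mul_r gI bI).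
have gP x : same_block (perm_CS g) (inl x) (inr (g x)) by rewrite sb_perm.
rewrite bE; suff -> : k = (g^-1)%g by [].
apply/permP=> y; have := above_perm_inverse inv gP (g^-1%g y).
by rewrite bE sb_perm permKV => /eqP.
Qed.

Lemma maximal_subsemigroupP (U S : {set CS X}) :
  reflect [/\ subsemigroup S, S \proper U &
             forall T, subsemigroup T -> T \proper U -> S \subset T -> T = S]
          (maximal_subsemigroup U S).
Proof.
apply: (iffP maxsetP) => [[/andP[sS SU] max]|[sS SU max]].
  by split=> // T sT TU; apply: max; rewrite sT.
by split=> [|T /andP[sT TU]]; [rewrite sS|apply: max].
Qed.

End Ideals.

(** * The two families of maximal subsemigroups *)

Section MaximalSubsemigroups.
Variable n : nat.
Implicit Types (a b c : CS 'I_n) (S T : {set CS 'I_n}) (g h : 'S_n).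

(** Such an element is a permutation, possibly times a merge; containing a permutation forces the
    merge to be uniform, that is, conjugate to [tau]. *)
Lemma above_perm_sub_IT (hn : 1 < n) a : a \in above_perm 'I_n -> a \in IP 'I_n ->
  n.-1 <= CS_rank a -> a \in IT hn.
Proof.
move=> aF aI ra.
have tauG : tau (Ordinal (ltnW hn)) (Ordinal hn) \in IT hn.
  by apply: (subsetP (sub_generated _)); apply: setU11.
have permG g : perm_CS g \in IT hn.
  by apply: (subsetP (sub_generated _)); apply/setU1P; right; apply: imset_f.
rewrite -{1}(card_ord n) in ra.
have [[g ->//]|[g [r [p [s [pr sr aE]]]]]] := corank1_decomp aI ra.
move: aF; rewrite aE perm_merge_above // => /eqP <-.
apply: generated_mul => //.
rewrite tau_merge // in tauG.
have [||//|h [<- <-]] := @perm_map_seq _ [:: Ordinal hn; Ordinal (ltnW hn)] [:: r; p] => //.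
  by rewrite /= !inE eq_sym pr.
by rewrite -merge_conj; do 2?apply: generated_mul.
Qed.

Lemma IT_sub (hn : 1 < n) : IT hn \subset above_perm 'I_n :&: IP 'I_n.
Proof.
apply: generated_min.
  apply/subsemigroupP; split.
    by apply/set0Pn; exists (perm_CS 1); rewrite in_setI above_perm_perm perm_CS_IP.
  move=> a b /setIP[aF aI] /setIP[bF bI].
  by rewrite in_setI above_perm_mul // IP_mul.
apply/subsetP=> a /setU1P[->|/imsetP[g _ ->]].
  by rewrite tau_merge // in_setI above_perm_merge merge_IP.
by rewrite in_setI above_perm_perm perm_CS_IP.
Qed.

(** In rank at least [n - 1] the two sets agree, and the ideal absorbs the rest; membership becomes
    explicit. *)
Lemma IT_setU_idealE (hn : 1 < n) :
  IT hn :|: IP_rank_le 'I_n (n - 2) =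
  (above_perm 'I_n :&: IP 'I_n) :|: IP_rank_le 'I_n (n - 2).
Proof.
apply/eqP; rewrite eqEsubset setSU ?IT_sub //=.
apply/subsetP=> a /setUP[/setIP[aF aI]|aI]; last by rewrite in_setU aI orbT.
rewrite in_setU; have [le|gt] := leqP (CS_rank a) (n - 2).
  by apply/orP; right; apply/rank_leP.
by rewrite above_perm_sub_IT //; lia.
Qed.

Lemma IT_setU_ideal_proper (hn : 2 < n) :
  IT (ltnW hn) :|: IP_rank_le 'I_n (n - 2) \proper IP 'I_n.
Proof.
rewrite IT_setU_idealE properE; apply/andP; split.
  by apply/subsetP=> a /setUP[/setIP[]//|/rank_leP[]].
(* Three distinct points give a non-uniform merge of rank at least [n - 1]; this is where [n] must
   be at least 3. *)
pose r := Ordinal (ltnW (ltnW hn)); pose p := Ordinal (ltnW hn); pose s := Ordinal hn.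
apply/subsetPn; exists (merge_CS r p s); first exact: merge_IP.
rewrite in_setU in_setI (negbTE (@merge_not_above _ r p s _ _ _)) //=.
apply/negP => /rank_leP[_]; apply/negP; rewrite -ltnNge.
apply: leq_trans (@rank_merge _ r p s isT isT); rewrite card_ord; lia.
Qed.

Lemma IT_setU_ideal_subsemigroup (hn : 1 < n) :
  subsemigroup (IT hn :|: IP_rank_le 'I_n (n - 2)).
Proof.
apply: subsemigroup_setU_ideal.
- apply/set0Pn; exists (perm_CS 1); apply: (subsetP (sub_generated _)).
  by apply/setU1P; right; apply: imset_f.
- exact: subset_trans (IT_sub hn) (subsetIr _ _).
by move=> a b aG bG; rewrite in_setU generated_mul.
Qed.

(** An element of [T] outside the right-hand side would make [T] all of [IP] by
    [subsemigroup_eq_IP]. *)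
Lemma sub_IT_setU_ideal (hn : 1 < n) T : subsemigroup T -> T \proper IP 'I_n ->
  (forall g, perm_CS g \in T) -> T \subset IT hn :|: IP_rank_le 'I_n (n - 2).
Proof.
move=> sT /andP[TI nIT] Tp; rewrite IT_setU_idealE; apply/subsetP=> a aT.
have aI := subsetP TI _ aT.
rewrite in_setU in_setI aI andbT; have [//|aF] := boolP (a \in above_perm 'I_n).
apply/rank_leP; split=> //; rewrite leqNgt; apply: contra nIT => ra.
by rewrite -(subsemigroup_eq_IP sT TI Tp aT aF) // card_ord; lia.
Qed.

Lemma IT_setU_ideal_maximal (hn : 2 < n) :
  maximal_subsemigroup (IP 'I_n) (IT (ltnW hn) :|: IP_rank_le 'I_n (n - 2)).
Proof.
apply/maximal_subsemigroupP; split.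
- exact: IT_setU_ideal_subsemigroup.
- exact: IT_setU_ideal_proper.
move=> T sT TI sub; apply/eqP; rewrite eqEsubset sub andbT.
apply: sub_IT_setU_ideal => // g; apply: (subsetP sub); apply/setUP; left.
apply: (subsetP (sub_generated _)); apply/setU1P; right; exact: imset_f.
Qed.

Lemma perm_part_group S : subsemigroup S -> (exists g, perm_CS g \in S) ->
  group_set [set g : 'S_n | perm_CS g \in S].
Proof.
case/subsemigroupP=> _ SM [g gS]; apply/group_setP; split; last first.
  by move=> h k; rewrite !inE -perm_CS_M; apply: SM.
(* By finiteness the identity is a positive power of [g]. *)
rewrite inE -(expg_order g); case: #[g]%g (order_gt0 g) => // m _.
by elim: m => [|m IHm]; rewrite ?expg1 // expgS -perm_CS_M; apply: SM.
Qed.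

Lemma mem_setU_ideal S a : a \in IP 'I_n ->
  (a \in S :|: IP_rank_le 'I_n (n - 1)) = (a \in S) || (CS_rank a <= n - 1).
Proof. by move=> aI; rewrite in_setU; congr orb; apply/rank_leP/idP => [[]|]. Qed.

Lemma rank_permF g : 0 < n -> CS_rank (perm_CS g) <= n - 1 = false.
Proof. by move=> n0; rewrite rank_perm card_ord; lia. Qed.

Lemma group_setU_ideal_subsemigroup (G : {group 'S_n}) :
  subsemigroup ([set perm_CS g | g in G] :|: IP_rank_le 'I_n (n - 1)).
Proof.
apply: subsemigroup_setU_ideal.
- by apply/set0Pn; exists (perm_CS 1); apply: imset_f.
- by apply/subsetP=> _ /imsetP[g _ ->]; apply: perm_CS_IP.
move=> _ _ /imsetP[g gG ->] /imsetP[h hG ->]; apply/setUP; left.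
by rewrite perm_CS_M imset_f ?groupM.
Qed.

Lemma group_setU_idealP (G : {group 'S_n}) g : 0 < n ->
  (perm_CS g \in [set perm_CS g | g in G] :|: IP_rank_le 'I_n (n - 1)) = (g \in G).
Proof.
move=> n0; rewrite mem_setU_ideal ?perm_CS_IP // rank_permF // orbF.
exact/mem_imset/perm_CS_inj.
Qed.

Lemma group_setU_ideal_proper (G : {group 'S_n}) : 0 < n -> G \proper [set: 'S_n] ->
  [set perm_CS g | g in G] :|: IP_rank_le 'I_n (n - 1) \proper IP 'I_n.
Proof.
move=> n0 /properP[_ [g _ gG]]; apply/properP; split.
  by apply/subsetP=> _ /setUP[/imsetP[h _ ->]|/rank_leP[] //]; apply: perm_CS_IP.
by exists (perm_CS g); rewrite ?perm_CS_IP // group_setU_idealP.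
Qed.

Lemma sub_group_setU_ideal (G : {group 'S_n}) T : T \subset IP 'I_n ->
  (forall g, perm_CS g \in T -> g \in G) ->
  T \subset [set perm_CS g | g in G] :|: IP_rank_le 'I_n (n - 1).
Proof.
move=> TI TG; apply/subsetP=> a aT; have aI := subsetP TI _ aT.
rewrite mem_setU_ideal //; have [le|gt] := leqP (CS_rank a) (n - 1).
  by rewrite orbT.
have [|g E] := rank_max_perm aI; first by rewrite card_ord; lia.
by rewrite orbF E imset_f // TG // -E.
Qed.

Lemma group_setU_ideal_maximal (G : {group 'S_n}) : 0 < n -> maximal G [set: 'S_n] ->
  maximal_subsemigroup (IP 'I_n) ([set perm_CS g | g in G] :|: IP_rank_le 'I_n (n - 1)).
Proof.
move=> n0 /maxgroupP[GT Gmax]; apply/maximal_subsemigroupP; split.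
- exact: group_setU_ideal_subsemigroup.
- exact: group_setU_ideal_proper.
move=> T sT /andP[TI nIT] sub; apply/eqP; rewrite eqEsubset sub andbT.
have GK g : g \in G -> perm_CS g \in T.
  by move=> gG; apply: (subsetP sub); rewrite group_setU_idealP.
have KG := perm_part_group sT (ex_intro _ 1%g (GK _ (group1 G))).
apply: sub_group_setU_ideal => // g gT.
rewrite -(Gmax (Group KG)) ?inE //; last by apply/subsetP=> h /GK hT; rewrite inE.
(* If [T] contained every permutation, then together with the ideal it would be all of [IP]. *)
rewrite properT; apply: contraNneq nIT => KT.
apply/subsetP=> a aI; have [lt|ge] := ltnP (CS_rank a) n.
  by apply: (subsetP sub); rewrite mem_setU_ideal //; apply/orP; right; lia.
have [|h ->] := rank_max_perm aI; first by rewrite card_ord.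
by have := in_setT h; rewrite -KT inE.
Qed.

Lemma maximal_subsemigroup_cases (hn : 2 < n) S : maximal_subsemigroup (IP 'I_n) S ->
  S = IT (ltnW hn) :|: IP_rank_le 'I_n (n - 2) \/
  exists G : {group 'S_n}, maximal G [set: 'S_n] /\
    S = [set perm_CS g | g in G] :|: IP_rank_le 'I_n (n - 1).
Proof.
case/maximal_subsemigroupP=> sS SI Smax; have n0 : 0 < n by lia.
have [/forallP Sp|] := boolP [forall g, perm_CS g \in S].
  left; apply/esym/Smax; last exact: sub_IT_setU_ideal.
    exact: IT_setU_ideal_subsemigroup.
  exact: IT_setU_ideal_proper.
rewrite negb_forall => /existsP[g0 g0S]; right.
have SIP := proper_sub SI.
(* Any proper subgroup [K] containing the permutations of [S] gives a proper subsemigroup above [S],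
   which maximality makes equal to [S]. *)
have Seq (K : {group 'S_n}) : K \proper [set: 'S_n] ->
    (forall g, perm_CS g \in S -> g \in K) ->
    S = [set perm_CS g | g in K] :|: IP_rank_le 'I_n (n - 1).
  move=> KT SK; apply/esym/Smax; first exact: group_setU_ideal_subsemigroup.
    exact: group_setU_ideal_proper.
  exact: sub_group_setU_ideal.
(* Without permutations in [S], taking [K] trivial would put the identity in [S]. *)
have Sperm : exists g, perm_CS g \in S.
  apply/existsP; apply/contraT; rewrite negb_exists => /forallP noS.
  have := noS 1%g; rewrite (Seq 1%G) ?group_setU_idealP ?group1 //.
    rewrite properEcard subsetT cards1 cardsT card_Sn.
    by rewrite (leq_trans (ltnW hn)) // fact_geq.
  by move=> g gS; have := noS g; rewrite gS.
pose G := Group (perm_part_group sS Sperm).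
have GT : G \proper [set: 'S_n].
  by apply/properP; split; [exact: subsetT|exists g0; rewrite ?inE].
exists G; split; last by apply: Seq => // g; rewrite inE.
apply/maxgroupP; split=> // K KT GK; apply/eqP; rewrite eqEsubset GK andbT.
(* Applied to an intermediate [K], [Seq] shows that every permutation of [K] is already in [S]. *)
apply/subsetP=> g gK; rewrite inE (Seq K) ?group_setU_idealP //.
by move=> h hS; apply: (subsetP GK); rewrite inE.
Qed.

(** Inverses do not raise the rank, so the ideals are closed under them; the other parts follow from
    [above_perm_inverse] and [perm_inverse]. *)
Lemma maximal_subsemigroup_inverse (hn : 2 < n) S :
  maximal_subsemigroup (IP 'I_n) S -> inverse_subsemigroup (IP 'I_n) S.
Proof.
move=> maxS; have [sS /proper_sub SI _] := maximal_subsemigroupP _ _ maxS.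
split=> // a b aS inv; have aI := subsetP SI _ aS; have [bI _ _] := inv.
have rb := rank_inverse aI inv.
case: (maximal_subsemigroup_cases hn maxS) aS => [->|[G [_ ->]]].
  rewrite IT_setU_idealE => /setUP[/setIP[/above_permP[h ah] _]|/rank_leP[_ ra]].
    apply/setUP; left; apply/setIP; split=> //; apply/above_permP.
    by exists (h^-1)%g => x; have := above_perm_inverse inv ah (h^-1%g x); rewrite permKV.
  by apply/setUP; right; apply/rank_leP; split=> //; apply: leq_trans ra.
case/setUP=> [/imsetP[g gG aE]|/rank_leP[_ ra]]; apply/setUP.
  by left; move: inv; rewrite aE => /perm_inverse->; rewrite imset_f ?groupV.
by right; apply/rank_leP; split=> //; apply: leq_trans ra.
Qed.

End MaximalSubsemigroups.

Theorem theorem3 (n : nat) (hn : 2 < n) :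
  (forall S : {set CS 'I_n}, S \subset IP 'I_n ->
     (maximal_subsemigroup (IP 'I_n) S <->
        S = IT (ltnW hn) :|: IP_rank_le 'I_n (n - 2) \/
        exists G : {group 'S_n},
          maximal G [set: 'S_n] /\
          S = [set perm_CS g | g in G] :|: IP_rank_le 'I_n (n - 1)))
  /\
  (forall S : {set CS 'I_n},
     maximal_subsemigroup (IP 'I_n) S -> inverse_subsemigroup (IP 'I_n) S).
Proof.
split=> [S _|S]; last exact: maximal_subsemigroup_inverse.
split=> [|[->|[G [Gmax ->]]]]; first exact: maximal_subsemigroup_cases.
  exact: IT_setU_ideal_maximal.
by apply: group_setU_ideal_maximal => //; lia.
Qed.
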